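(* There exists a recursive coloring function $c:\mathbb{N}\rightarrow r$ (for some natural number $r\geq 2$) such that for every infinite $\Delta^0_3$ set $A\subseteq\mathbb{Z}^+$ with weak apartness, there exist $x\ll w_1\ll w_2$ in $A$ such that $c(w_1+w_2)\neq c(x+w_1+w_2)$. Hence $FS^{\leq 3}(A)$ is not monochromatic under $c$.
   Context: For $x=\sum_{i=0}^{k}2^{n_i}\in\mathbb{Z}^+$ with $n_0<\cdots<n_k$, set $\mu(x)=n_k$ and $\lambda(x)=n_0$. For positive integers $x<y$, write $x\ll y$ if $\mu(x)<\lambda(y)$. For each $n$, $B^n=\{x\in\mathbb{Z}^+:\mu(x)=n\}$. A set $A$ has weak apartness if for every natural number $m$, $B^m\cap A$ has at most one element, and for every natural number $l$, there are at most two $x\in A$ with $\lambda(x)=l$. $FS^{\leq 3}(A)=\{\sum_{x\in F}x: F\subseteq A,\ F \text{ nonempty},\ |F|\leq 3\}$. *)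

(* Defs.v *)
From Stdlib Require Import Arith List Lia.
Import ListNotations.

Inductive code : Type :=
| CZero : code
| CSucc : code
| CProj : nat -> code
| CComp : code -> list code -> code
| CPrec : code -> code -> code
| CMu   : code -> code.

Inductive eval : code -> list nat -> nat -> Prop :=
| eZero : forall v, eval CZero v 0
| eSucc : forall x v, eval CSucc (x :: v) (S x)
| eProj : forall i v, i < length v -> eval (CProj i) v (nth i v 0)
| eComp : forall f gs v ys y,
    Forall2 (fun g y => eval g v y) gs ys -> eval f ys y -> eval (CComp f gs) v y
| ePrec0 : forall f g v y, eval f v y -> eval (CPrec f g) (0 :: v) y
| ePrecS : forall f g n v z y,
    eval (CPrec f g) (n :: v) z -> eval g (n :: z :: v) y ->
    eval (CPrec f g) (S n :: v) y
| eMu : forall f v n,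
    eval f (n :: v) 0 ->
    (forall m, m < n -> exists k, eval f (m :: v) (S k)) ->
    eval (CMu f) v n.

Definition recursive_fun (f : nat -> nat) : Prop :=
  exists e, forall n, eval e [n] (f n).

Definition recursive_rel4 (R : nat -> nat -> nat -> nat -> Prop) : Prop :=
  exists e, forall x a b c,
    (R x a b c -> eval e [x; a; b; c] 0) /\ (~ R x a b c -> eval e [x; a; b; c] 1).

Definition Sigma03 (A : nat -> Prop) : Prop :=
  exists R, recursive_rel4 R /\
    forall x, A x <-> exists a, forall b, exists c, R x a b c.

Definition Pi03 (A : nat -> Prop) : Prop :=
  exists R, recursive_rel4 R /\
    forall x, A x <-> forall a, exists b, forall c, R x a b c.

Definition Delta03 (A : nat -> Prop) : Prop := Sigma03 A /\ Pi03 A.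

(** Binary-expansion exponents. For x = sum_{i<=k} 2^{n_i}, n_0 < ... < n_k:
    mu x = n_k (highest bit), lambda x = n_0 (lowest bit). *)
Definition mu (x : nat) : nat := Nat.log2 x.

Fixpoint tz (fuel x : nat) : nat :=
  match fuel with
  | 0 => 0
  | S f => if Nat.odd x then 0 else S (tz f (Nat.div2 x))
  end.

Definition lambda (x : nat) : nat := tz x x.

Definition ll (x y : nat) : Prop := x < y /\ mu x < lambda y.

Definition infinite_set (A : nat -> Prop) : Prop :=
  forall n, exists x, n < x /\ A x.

Definition weak_apartness (A : nat -> Prop) : Prop :=
  (forall m x y, A x -> A y -> mu x = m -> mu y = m -> x = y) /\
  (forall l x y z, A x -> A y -> A z ->
     lambda x = l -> lambda y = l -> lambda z = l ->
     x = y \/ x = z \/ y = z).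

Definition FS3 (A : nat -> Prop) (s : nat) : Prop :=
  exists F : list nat, NoDup F /\ 1 <= length F <= 3 /\
    (forall y, In y F -> A y) /\ s = fold_right Nat.add 0 F.

(* Main.v *)
Require Import Defs.
From Stdlib Require Import Arith List Lia Cantor Classical.
Import ListNotations.

(** Let [h] be a function of two bits [a < b], computable in the limit
    [h a b = lim_t h_t a b], and colour [z] with top bit [t] by the sum modulo 2 of
    [h_t a b] over the consecutive bits [a < b] of [z].  For [x << w1 << w2] the
    contributions of [w1 + w2] cancel in [c (x + w1 + w2) - c (w1 + w2)], leaving the
    sum over the bits of [x] plus the single term at [(mu x, lambda w1)].  So it is
    enough to choose [h (mu x) b], for [x] in the [e]-th Delta^0_3 set [A] and all
    large [b], as 1 plus the sum over [x].  To serve all [e] at once, stage [b] gives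
    each top bit [a] to the least unserved [e < b] whose approximation at [b] has an
    element with top bit [a]; the [e]-th set loses at most [e] of its top bits to
    smaller indices.  By weak apartness [lambda] is unbounded on [A], so [w1] and then
    [w2] can be taken so large that the double limit defining [A] has settled.
    The approximations are uniform in [e] thanks to a recursive enumeration of all
    computations, obtained by turning the rules of [eval] into numerical proofs. *)

(** * Cantor pairing and its closed form *)

Definition pr (x y : nat) : nat := to_nat (x, y).
Definition pfst (n : nat) : nat := fst (of_nat n).
Definition psnd (n : nat) : nat := snd (of_nat n).

Lemma pfst_pr x y : pfst (pr x y) = x.
Proof. unfold pfst, pr; now rewrite cancel_of_to. Qed.

Lemma psnd_pr x y : psnd (pr x y) = y.
Proof. unfold psnd, pr; now rewrite cancel_of_to. Qed.

Lemma pr_eta n : pr (pfst n) (psnd n) = n.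
Proof.
  unfold pr, pfst, psnd; rewrite <- surjective_pairing; apply cancel_to_of.
Qed.

Lemma pr_inj x y x' y' : pr x y = pr x' y' -> x = x' /\ y = y'.
Proof.
  intros E; split.
  - now rewrite <- (pfst_pr x y), E, pfst_pr.
  - now rewrite <- (psnd_pr x y), E, psnd_pr.
Qed.

Fixpoint tri (n : nat) : nat :=
  match n with 0 => 0 | S m => S m + tri m end.

Lemma tri_mono m n : m <= n -> tri m <= tri n.
Proof. induction 1; simpl; lia. Qed.

Lemma pr_tri x y : pr x y = y + tri (x + y).
Proof.
  unfold pr, to_nat; f_equal; rewrite (Nat.add_comm y x).
  induction (x + y) as [|n IH]; [reflexivity|].
  simpl in *; now rewrite IH.
Qed.

Lemma pr_ge x y : x + y <= pr x y.
Proof.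
  rewrite pr_tri; enough (forall n, n <= tri n) by (specialize (H (x + y)); lia).
  induction n; simpl; lia.
Qed.

(** * Closure properties of recursive functions *)

Notation rec := recursive_fun.

Definition rec2 (f : nat -> nat -> nat) : Prop :=
  exists e, forall x y, eval e [x; y] (f x y).

Lemma eval_proj (i : nat) v y : nth_error v i = Some y -> eval (CProj i) v y.
Proof.
  intros H. rewrite <- (nth_error_nth v i 0 H). constructor.
  apply nth_error_Some. congruence.
Qed.

Lemma eval_comp1 f g v y z : eval g v y -> eval f [y] z -> eval (CComp f [g]) v z.
Proof. intros; econstructor; eauto. Qed.

Lemma eval_comp2 f g h v y y' z :
  eval g v y -> eval h v y' -> eval f [y; y'] z -> eval (CComp f [g; h]) v z.
Proof. intros; econstructor; eauto. Qed.

Ltac proj := apply eval_proj; reflexivity.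

Lemma eval_prec f g v (F : nat -> nat) :
  eval f v (F 0) ->
  (forall n, eval g (n :: F n :: v) (F (S n))) ->
  forall n, eval (CPrec f g) (n :: v) (F n).
Proof.
  intros H0 HS n; induction n; [now constructor|].
  econstructor; eauto.
Qed.

Lemma rec_ext f g : (forall x, f x = g x) -> rec f -> rec g.
Proof. intros E [e He]; exists e; intros n; rewrite <- E; apply He. Qed.

Lemma rec_id : rec (fun x => x).
Proof. exists (CProj 0); intros; proj. Qed.

Lemma rec_comp f g : rec f -> rec g -> rec (fun x => f (g x)).
Proof.
  intros [e He] [d Hd]; exists (CComp e [d]); intros n.
  eapply eval_comp1; eauto.
Qed.

Lemma rec_comp2 f g h : rec2 f -> rec g -> rec h -> rec (fun x => f (g x) (h x)).
Proof.
  intros [e He] [d Hd] [d' Hd']; exists (CComp e [d; d']); intros n.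
  eapply eval_comp2; eauto.
Qed.

Lemma rec_S f : rec f -> rec (fun x => S (f x)).
Proof.
  intros [e He]; exists (CComp CSucc [e]); intros n.
  eapply eval_comp1; [apply He|constructor].
Qed.

Lemma rec_const k : rec (fun _ => k).
Proof.
  induction k; [exists CZero; constructor|].
  now apply rec_S.
Qed.

Lemma rec2_add : rec2 Nat.add.
Proof.
  exists (CPrec (CProj 0) (CComp CSucc [CProj 1])); intros x y.
  apply (eval_prec _ _ [y] (fun x => x + y)); [proj|].
  intros n; eapply eval_comp1; [proj|constructor].
Qed.

Lemma rec_add f g : rec f -> rec g -> rec (fun x => f x + g x).
Proof. apply rec_comp2, rec2_add. Qed.

Lemma eval_pred : forall n, eval (CPrec CZero (CProj 0)) [n] (pred n).
Proof.
  apply (eval_prec _ _ [] pred); [constructor|intros; proj].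
Qed.

(** The arguments are reversed because [CPrec] recurses on the first one. *)
Lemma rec2_rsub : rec2 (fun x y => y - x).
Proof.
  exists (CPrec (CProj 0) (CComp (CPrec CZero (CProj 0)) [CProj 1])); intros x y.
  apply (eval_prec _ _ [y] (fun x => y - x)).
  - rewrite Nat.sub_0_r; proj.
  - intros n; eapply eval_comp1; [proj|].
    rewrite Nat.sub_succ_r; apply eval_pred.
Qed.

Lemma rec_sub f g : rec f -> rec g -> rec (fun x => f x - g x).
Proof. intros; now apply (rec_comp2 _ g f rec2_rsub). Qed.

Lemma rec_tri f : rec f -> rec (fun x => tri (f x)).
Proof.
  intros Hf; apply (rec_comp tri); [|exact Hf].
  destruct rec2_add as [a Ha].
  exists (CPrec CZero (CComp a [CComp CSucc [CProj 0]; CProj 1])).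
  apply (eval_prec _ _ [] tri); [constructor|].
  intros n; eapply eval_comp2; [|proj|apply Ha].
  eapply eval_comp1; [proj|constructor].
Qed.

Lemma rec2_pr : rec2 pr.
Proof.
  destruct rec2_add as [a Ha]; destruct (rec_tri _ rec_id) as [t Ht].
  exists (CComp a [CProj 1; CComp t [CComp a [CProj 0; CProj 1]]]); intros x y.
  rewrite pr_tri; eapply eval_comp2; [proj| |apply Ha].
  eapply eval_comp1; [|apply Ht]. eapply eval_comp2; [proj|proj|apply Ha].
Qed.

Lemma rec_pr f g : rec f -> rec g -> rec (fun x => pr (f x) (g x)).
Proof. apply rec_comp2, rec2_pr. Qed.

(** The diagonal of the pair coded by [n] is the least [m] with [n < tri (S m)], found by unbounded
    search: [S n - tri (S m)] vanishes exactly for such [m]. *)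
Lemma rec_psum : rec (fun n => pfst n + psnd n).
Proof.
  destruct rec2_rsub as [s Hs]; destruct (rec_tri _ rec_id) as [t Ht].
  exists (CMu (CComp s [CComp t [CComp CSucc [CProj 0]]; CComp CSucc [CProj 1]])).
  intros n.
  assert (E : forall m, eval (CComp s [CComp t [CComp CSucc [CProj 0]];
             CComp CSucc [CProj 1]]) [m; n] (S n - tri (S m))).
  { intros m; eapply eval_comp2; [| |apply Hs].
    - eapply eval_comp1; [|apply Ht]. eapply eval_comp1; [proj|constructor].
    - eapply eval_comp1; [proj|constructor]. }
  pose proof (pr_eta n) as Hn; rewrite pr_tri in Hn.
  constructor.
  - specialize (E (pfst n + psnd n)).
    replace (S n - tri (S (pfst n + psnd n))) with 0 in E by (simpl; lia).
    exact E.
  - intros m Hm; exists (n - tri (S m)).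
    pose proof (tri_mono _ _ Hm).
    replace (S (n - tri (S m))) with (S n - tri (S m)) by lia.
    apply E.
Qed.

Lemma rec_psnd f : rec f -> rec (fun x => psnd (f x)).
Proof.
  apply (rec_comp psnd), (rec_ext (fun n => n - tri (pfst n + psnd n))).
  - intros n; pose proof (pr_eta n) as Hn; rewrite pr_tri in Hn; lia.
  - apply rec_sub; [apply rec_id|]. apply rec_tri, rec_psum.
Qed.

Lemma rec_pfst f : rec f -> rec (fun x => pfst (f x)).
Proof.
  apply (rec_comp pfst), (rec_ext (fun n => (pfst n + psnd n) - psnd n)).
  - intros n; lia.
  - apply rec_sub; [apply rec_psum|]. apply rec_psnd, rec_id.
Qed.

(** Packing the three arguments of [g] into one number keeps the closure rules about unary
    functions, so that proof search can chain them. *)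
Lemma rec_nat_rect (b n : nat -> nat) (g : nat -> nat -> nat -> nat) :
  rec b -> rec n -> rec (fun p => g (pfst p) (pfst (psnd p)) (psnd (psnd p))) ->
  rec (fun x => nat_rect (fun _ => nat) (b x) (g x) (n x)).
Proof.
  intros [eb Hb] [en Hn] [eg Hg].
  destruct rec2_pr as [q Hq].
  exists (CComp (CPrec eb (CComp eg [CComp q [CProj 2; CComp q [CProj 0; CProj 1]]]))
            [en; CProj 0]).
  intros x; eapply eval_comp2; [apply Hn|proj|].
  apply (eval_prec _ _ [x] (nat_rect (fun _ => nat) (b x) (g x))); [apply Hb|].
  intros i; simpl.
  eapply eval_comp1.
  - eapply eval_comp2; [proj| |apply Hq].
    eapply eval_comp2; [proj|proj|apply Hq].
  - specialize (Hg (pr x (pr i (nat_rect (fun _ => nat) (b x) (g x) i)))).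
    now rewrite !psnd_pr, !pfst_pr in Hg.
Qed.

Global Opaque pr pfst psnd.

Create HintDb rec discriminated.
#[local] Hint Constants Opaque : rec.
#[local] Hint Variables Opaque : rec.
#[local] Hint Resolve rec_id rec_S rec_add rec_sub rec_pr rec_pfst rec_psnd
  rec_nat_rect | 2 : rec.
#[local] Hint Resolve rec_const | 1 : rec.
#[local] Hint Extern 3 (recursive_fun (fun x => ?f (@?g x))) =>
  match goal with H : recursive_fun f |- _ => apply (rec_comp f g H) end : rec.
#[local] Hint Extern 3 (recursive_fun ?f) =>
  match goal with H : recursive_fun f |- _ => exact H end : rec.

Ltac solve_rec := cbv beta; auto 100 with rec nocore.

(** * Decidable predicates and bounded search *)

Definition recb (P : nat -> bool) : Prop := rec (fun x => Nat.b2n (P x)).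

Lemma rec_if (P : nat -> bool) f g :
  recb P -> rec f -> rec g -> rec (fun x => if P x then f x else g x).
Proof.
  intros HP Hf Hg; unfold recb in HP.
  apply (rec_ext (fun x => nat_rect (fun _ => nat) (g x) (fun _ _ => f x) (Nat.b2n (P x)))).
  - intros x; now destruct (P x).
  - apply (rec_nat_rect g _ (fun x _ _ => f x)); solve_rec.
Qed.

Lemma recb_andb P Q : recb P -> recb Q -> recb (fun x => P x && Q x)%bool.
Proof.
  intros HP HQ; unfold recb.
  apply (rec_ext (fun x => if P x then Nat.b2n (Q x) else 0)).
  - intros x; now destruct (P x).
  - apply rec_if; auto. apply rec_const.
Qed.

Lemma recb_negb P : recb P -> recb (fun x => negb (P x)).
Proof.
  intros HP; unfold recb.
  apply (rec_ext (fun x => if P x then 0 else 1)).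
  - intros x; now destruct (P x).
  - apply rec_if; auto using rec_const.
Qed.

Lemma recb_ltb f g : rec f -> rec g -> recb (fun x => f x <? g x).
Proof.
  intros Hf Hg; unfold recb.
  apply (rec_ext (fun x => 1 - (1 - (g x - f x)))).
  - intros x; destruct (Nat.ltb_spec (f x) (g x)); simpl Nat.b2n; lia.
  - solve_rec.
Qed.

Lemma recb_eqb f g : rec f -> rec g -> recb (fun x => f x =? g x).
Proof.
  intros Hf Hg; unfold recb.
  apply (rec_ext (fun x => 1 - ((g x - f x) + (f x - g x)))).
  - intros x; destruct (Nat.eqb_spec (f x) (g x)); simpl Nat.b2n; lia.
  - solve_rec.
Qed.

Lemma rec_b2n P : recb P -> rec (fun x => Nat.b2n (P x)).
Proof. trivial. Qed.

#[local] Hint Resolve rec_if recb_andb recb_negb recb_ltb recb_eqb rec_b2n | 2 : rec.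

Lemma recb_odd f : rec f -> recb (fun x => Nat.odd (f x)).
Proof.
  intros Hf; unfold recb.
  apply (rec_ext (fun x => nat_rect (fun _ => nat) 0 (fun _ r => 1 - r) (f x))).
  - intros x; induction (f x) as [|n IH]; [reflexivity|].
    cbn [nat_rect]; rewrite IH, Nat.odd_succ, <- Nat.negb_odd.
    now destruct (Nat.odd n).
  - solve_rec.
Qed.

Lemma rec_pow2 f : rec f -> rec (fun x => 2 ^ f x).
Proof.
  intros Hf; apply (rec_ext (fun x => nat_rect (fun _ => nat) 1 (fun _ r => r + r) (f x))).
  - intros x; induction (f x) as [|n IH]; [reflexivity|].
    cbn [nat_rect]; rewrite IH; simpl; lia.
  - solve_rec.
Qed.

Fixpoint bex (P : nat -> bool) (n : nat) : bool :=
  match n with 0 => false | S m => if P m then true else bex P m end.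

Definition ball (P : nat -> bool) (n : nat) : bool := negb (bex (fun i => negb (P i)) n).

(** [bmin P n] is [n] when [P] fails below [n]. *)
Fixpoint bmin (P : nat -> bool) (n : nat) : nat :=
  match n with
  | 0 => 0
  | S m => if bmin P m <? m then bmin P m else if P m then m else S m
  end.

Lemma bex_spec P n : bex P n = true <-> exists i, i < n /\ P i = true.
Proof.
  induction n; simpl.
  - split; [discriminate|]. intros (i & ? & _); lia.
  - destruct (P n) eqn:E.
    + split; [|reflexivity]. intros _; exists n; auto.
    + rewrite IHn; split; intros (i & Hi & Pi); exists i; split; auto.
      assert (i <> n) by congruence. lia.
Qed.

Lemma ball_spec P n : ball P n = true <-> forall i, i < n -> P i = true.
Proof.
  unfold ball; rewrite Bool.negb_true_iff, <- Bool.not_true_iff_false, bex_spec.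
  split.
  - intros H i Hi; destruct (P i) eqn:E; auto.
    exfalso; apply H; exists i; now rewrite E.
  - intros H (i & Hi & Pi); rewrite (H i Hi) in Pi; discriminate.
Qed.

Lemma bmin_true P n : bmin P n < n -> P (bmin P n) = true.
Proof.
  induction n; simpl; [lia|].
  destruct (Nat.ltb_spec (bmin P n) n); auto.
  destruct (P n) eqn:E; auto. lia.
Qed.

Lemma bmin_first P n i : i < n -> P i = true -> bmin P n <= i.
Proof.
  induction n; simpl; [lia|]; intros Hi Pi.
  destruct (Nat.ltb_spec (bmin P n) n) as [L|L].
  - destruct (Nat.eq_dec i n); [lia|]. apply IHn; auto; lia.
  - destruct (Nat.eq_dec i n) as [->|Ne]; [now rewrite Pi|].
    assert (bmin P n <= i) by (apply IHn; auto; lia). lia.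
Qed.

Lemma recb_bex (P : nat -> nat -> bool) n :
  recb (fun p => P (pfst p) (psnd p)) -> rec n -> recb (fun x => bex (P x) (n x)).
Proof.
  intros HP Hn; unfold recb.
  apply (rec_ext (fun x => nat_rect (fun _ => nat) 0
    (fun i r => if P x i then 1 else r) (n x))).
  - intros x; induction (n x) as [|m IH]; [reflexivity|].
    simpl; rewrite IH; now destruct (P x m).
  - apply (rec_nat_rect _ _ (fun x i r => if P x i then 1 else r)); solve_rec.
    apply rec_if; solve_rec.
    apply (rec_ext (fun p => (fun q => Nat.b2n (P (pfst q) (psnd q)))
             (pr (pfst p) (pfst (psnd p))))).
    + intros p; simpl; now rewrite pfst_pr, psnd_pr.
    + apply (rec_comp _ (fun p => pr (pfst p) (pfst (psnd p))) HP); solve_rec.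
Qed.

Lemma recb_ball (P : nat -> nat -> bool) n :
  recb (fun p => P (pfst p) (psnd p)) -> rec n -> recb (fun x => ball (P x) (n x)).
Proof.
  intros HP Hn; unfold ball. apply recb_negb, recb_bex; auto.
  apply (recb_negb (fun p => P (pfst p) (psnd p)) HP).
Qed.

Lemma rec_bmin (P : nat -> nat -> bool) n :
  recb (fun p => P (pfst p) (psnd p)) -> rec n -> rec (fun x => bmin (P x) (n x)).
Proof.
  intros HP Hn.
  apply (rec_ext (fun x => nat_rect (fun _ => nat) 0
    (fun i r => if r <? i then r else if P x i then i else S i) (n x))).
  - intros x; induction (n x) as [|m IH]; [reflexivity|].
    simpl; now rewrite IH.
  - apply (rec_nat_rect _ _
      (fun x i r => if r <? i then r else if P x i then i else S i)); solve_rec.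
    apply rec_if; solve_rec. apply rec_if; solve_rec.
    apply (rec_ext (fun p => (fun q => Nat.b2n (P (pfst q) (psnd q)))
             (pr (pfst p) (pfst (psnd p))))).
    + intros p; simpl; now rewrite pfst_pr, psnd_pr.
    + apply (rec_comp _ (fun p => pr (pfst p) (pfst (psnd p))) HP); solve_rec.
Qed.

#[local] Hint Resolve recb_odd rec_pow2 recb_bex recb_ball rec_bmin | 2 : rec.

Lemma rec_log2 f : rec f -> rec (fun x => Nat.log2 (f x)).
Proof.
  intros Hf.
  (* For positive [n], [log2 n] is the least [k] with [n < 2 ^ S k] and lies below [n]; for [n = 0]
     the empty search returns the right value 0. *)
  apply (rec_ext (fun x => bmin (fun k => f x <? 2 ^ S k) (f x))); [|solve_rec].
  intros x; generalize (f x); clear; intros n.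
  destruct (Nat.eq_dec n 0) as [->|Hn]; [reflexivity|].
  pose proof (Nat.log2_spec n ltac:(lia)) as [L1 L2].
  pose proof (Nat.log2_lt_lin n ltac:(lia)) as L3.
  assert (bmin (fun k => n <? 2 ^ S k) n <= Nat.log2 n) as B.
  { apply bmin_first; auto. now apply Nat.ltb_lt. }
  pose proof (bmin_true (fun k => n <? 2 ^ S k) n ltac:(lia)) as T.
  cbv beta in T; apply Nat.ltb_lt in T.
  apply Nat.le_antisymm; auto.
  apply Nat.log2_lt_pow2 in T; lia.
Qed.

(** * Recursion on a table of earlier values *)

Fixpoint tab (G : nat -> nat -> nat) (n : nat) : nat :=
  match n with 0 => 0 | S m => pr (G m (tab G m)) (tab G m) end.

(** Course-of-values recursion: [G n T] computes the value at [n], reading the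
    value at [i < n] as [lookup T n i]. *)
Definition cov (G : nat -> nat -> nat) (n : nat) : nat := G n (tab G n).

(** The latest value of [tab] is outermost, so the entry for [i] is reached after [n - S i] second
    projections. *)
Definition lookup (T n i : nat) : nat :=
  pfst (nat_rect (fun _ => nat) T (fun _ r => psnd r) (n - S i)).

Lemma lookup_tab G n i : i < n -> lookup (tab G n) n i = cov G i.
Proof.
  intros Hi; unfold lookup, cov.
  assert (E : forall k m, nat_rect (fun _ => nat) (tab G (k + m)) (fun _ r => psnd r) k
                     = tab G m).
  { clear; intros k; induction k as [|k IH]; intros m; [reflexivity|].
    replace (S k + m) with (k + S m) by lia.
    cbn [nat_rect]; rewrite IH; simpl; apply psnd_pr. }
  replace n with ((n - S i) + S i) at 1 by lia.
  rewrite E; simpl; apply pfst_pr.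
Qed.

Lemma rec_lookup f g h : rec f -> rec g -> rec h -> rec (fun x => lookup (f x) (g x) (h x)).
Proof. intros; unfold lookup; solve_rec. Qed.

Lemma rec_cov (G : nat -> nat -> nat -> nat) n :
  rec (fun p => G (pfst p) (pfst (psnd p)) (psnd (psnd p))) -> rec n ->
  rec (fun x => cov (G x) (n x)).
Proof.
  intros HG Hn.
  assert (HT : rec (fun x => tab (G x) (n x))).
  { apply (rec_ext (fun x => nat_rect (fun _ => nat) 0 (fun i r => pr (G x i r) r) (n x))).
    - intros x; induction (n x) as [|m IH]; [reflexivity|].
      simpl; now rewrite IH.
    - apply (rec_nat_rect _ _ (fun x i r => pr (G x i r) r)); solve_rec. }
  unfold cov.
  apply (rec_ext (fun x => (fun p => G (pfst p) (pfst (psnd p)) (psnd (psnd p)))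
           (pr x (pr (n x) (tab (G x) (n x)))))).
  - intros x; cbv beta; now rewrite !psnd_pr, !pfst_pr.
  - apply (rec_comp _ _ HG); solve_rec.
Qed.

#[local] Hint Resolve rec_log2 rec_lookup rec_cov | 2 : rec.

(** * A universal enumeration of computations *)

Definition fact (c v y : nat) : nat := pr c (pr v y).
Definition vcons (x v : nat) : nat := S (pr x v).

Fixpoint enc_list (l : list nat) : nat :=
  match l with [] => 0 | x :: l => vcons x (enc_list l) end.

(** Lists of codes are themselves given codes (tags 6 and 7), evaluating to the
    list of values.  Tag 8 is an auxiliary code: [(cpos f, n :: v, 0)] says that
    [f (m :: v)] is positive for all [m < n]. *)
Definition czero := pr 0 0.
Definition csucc := pr 1 0.
Definition cproj (i : nat) := pr 2 i.
Definition ccomp (f g : nat) := pr 3 (pr f g).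
Definition cprec (f g : nat) := pr 4 (pr f g).
Definition cmu (f : nat) := pr 5 f.
Definition cnil := pr 6 0.
Definition ccons (g h : nat) := pr 7 (pr g h).
Definition cpos (f : nat) := pr 8 f.

Fixpoint enc (k : code) : nat :=
  match k with
  | CZero => czero
  | CSucc => csucc
  | CProj i => cproj i
  | CComp f gs =>
      ccomp (enc f) ((fix encs l := match l with
                       | [] => cnil
                       | g :: l => ccons (enc g) (encs l)
                       end) gs)
  | CPrec f g => cprec (enc f) (enc g)
  | CMu f => cmu (enc f)
  end.

(** A named copy of the anonymous inner fixpoint of [enc], so that statements can mention it. *)
Fixpoint encs (l : list code) : nat :=
  match l with [] => cnil | g :: l => ccons (enc g) (encs l) end.

Lemma enc_comp f gs : enc (CComp f gs) = ccomp (enc f) (encs gs).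
Proof. reflexivity. Qed.

Definition fact0 : nat := fact czero 0 0.

(** The rule with tag [r] and parameters [a .. g], as a pair of premises and a
    conclusion; missing premises are filled with the axiom [fact0]. *)
Definition rule (r a b c d e g : nat) : nat :=
  if r =? 1 then pr (pr fact0 fact0) (fact czero a 0) else
  if r =? 2 then pr (pr fact0 fact0) (fact csucc (vcons a b) (S a)) else
  if r =? 3 then pr (pr fact0 fact0) (fact (cproj 0) (vcons a b) a) else
  if r =? 4 then pr (pr (fact (cproj a) b c) fact0) (fact (cproj (S a)) (vcons d b) c) else
  if r =? 5 then pr (pr fact0 fact0) (fact cnil a 0) else
  if r =? 6 then pr (pr (fact a b c) (fact d b e)) (fact (ccons a d) b (vcons c e)) else
  if r =? 7 then pr (pr (fact a b c) (fact d c e)) (fact (ccomp d a) b e) else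
  if r =? 8 then pr (pr (fact a b c) fact0) (fact (cprec a d) (vcons 0 b) c) else
  if r =? 9 then pr (pr (fact (cprec a b) (vcons c d) e) (fact b (vcons c (vcons e d)) g))
                    (fact (cprec a b) (vcons (S c) d) g) else
  if r =? 10 then pr (pr fact0 fact0) (fact (cpos a) (vcons 0 b) 0) else
  if r =? 11 then pr (pr (fact (cpos a) (vcons b c) 0) (fact a (vcons b c) (S d)))
                     (fact (cpos a) (vcons (S b) c) 0) else
  if r =? 12 then pr (pr (fact (cpos a) (vcons b c) 0) (fact a (vcons b c) 0))
                     (fact (cmu a) c b) else
  pr (pr fact0 fact0) fact0.

(** A proof is a number [pr r (pr (pr i j) params)], where [i] and [j] are proofs
    of the premises; a number that is not a proof is read as a proof of [fact0]. *)
Definition rule_of (n : nat) : nat :=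
  let q := psnd (psnd n) in
  rule (pfst n) (pfst q) (pfst (psnd q)) (pfst (psnd (psnd q)))
    (pfst (psnd (psnd (psnd q)))) (pfst (psnd (psnd (psnd (psnd q)))))
    (psnd (psnd (psnd (psnd (psnd q))))).

Definition thm_step (n T : nat) : nat :=
  if ((lookup T n (pfst (pfst (psnd n))) =? pfst (pfst (rule_of n))) &&
      (lookup T n (psnd (pfst (psnd n))) =? psnd (pfst (rule_of n))))%bool
  then psnd (rule_of n) else fact0.

Definition thm (n : nat) : nat := cov thm_step n.

Lemma rec_rule r a b c d e g : rec r -> rec a -> rec b -> rec c -> rec d -> rec e -> rec g ->
  rec (fun x => rule (r x) (a x) (b x) (c x) (d x) (e x) (g x)).
Proof.
  intros; unfold rule, fact0, fact, czero, csucc, cproj, ccomp, cprec, cmu, cnil,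
    ccons, cpos, vcons.
  solve_rec.
Qed.

#[local] Hint Resolve rec_rule | 2 : rec.

Lemma rec_thm f : rec f -> rec (fun x => thm (f x)).
Proof.
  intros Hf; unfold thm.
  apply (rec_cov (fun _ => thm_step)); auto.
  unfold thm_step, rule_of; cbv zeta; solve_rec.
Qed.

#[local] Hint Resolve rec_thm | 2 : rec.

(** * Derivations and the numbers that code them *)

Inductive derivable : nat -> Prop :=
| der_axiom : derivable fact0
| der_rule r a b c d e g F G H :
    rule r a b c d e g = pr (pr F G) H -> derivable F -> derivable G -> derivable H.

Lemma thm_fact0 n : pfst n = 0 -> thm n = fact0.
Proof.
  intros E.
  assert (R : rule_of n = pr (pr fact0 fact0) fact0) by (unfold rule_of; now rewrite E).
  change (thm_step n (tab thm_step n) = fact0); unfold thm_step.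
  rewrite R, psnd_pr; now destruct (_ && _)%bool.
Qed.

(** A nonzero tag makes both premise numbers strictly smaller than [n], so the table lookups return
    genuine values of [thm]. *)
Lemma thm_rule n : pfst n <> 0 ->
  thm n = if ((thm (pfst (pfst (psnd n))) =? pfst (pfst (rule_of n))) &&
              (thm (psnd (pfst (psnd n))) =? psnd (pfst (rule_of n))))%bool
          then psnd (rule_of n) else fact0.
Proof.
  intros E; change (thm n) with (thm_step n (tab thm_step n)).
  pose proof (pr_ge (pfst n) (psnd n)) as L1.
  pose proof (pr_ge (pfst (psnd n)) (psnd (psnd n))) as L2.
  pose proof (pr_ge (pfst (pfst (psnd n))) (psnd (pfst (psnd n)))) as L3.
  rewrite !pr_eta in *.
  unfold thm_step; now rewrite !lookup_tab by lia.
Qed.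

Lemma thm_derivable n : derivable (thm n).
Proof.
  induction n as [n IH] using lt_wf_ind.
  destruct (Nat.eq_dec (pfst n) 0) as [E|E].
  { rewrite thm_fact0 by exact E; constructor. }
  rewrite thm_rule by exact E.
  destruct (_ && _)%bool eqn:B; [|constructor].
  apply andb_prop in B as [B1 B2]; apply Nat.eqb_eq in B1, B2.
  pose proof (pr_ge (pfst n) (psnd n)) as L1.
  pose proof (pr_ge (pfst (psnd n)) (psnd (psnd n))) as L2.
  pose proof (pr_ge (pfst (pfst (psnd n))) (psnd (pfst (psnd n)))) as L3.
  rewrite !pr_eta in *.
  eapply (der_rule _ _ _ _ _ _ _ (pfst (pfst (rule_of n))) (psnd (pfst (rule_of n)))).
  - rewrite !pr_eta; unfold rule_of; reflexivity.
  - rewrite <- B1; apply IH; lia.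
  - rewrite <- B2; apply IH; lia.
Qed.

Lemma derivable_thm F : derivable F -> exists n, thm n = F.
Proof.
  assert (Z : exists n, thm n = fact0).
  { exists (pr 0 0); apply thm_fact0, pfst_pr. }
  induction 1 as [|r a b c d e g F G H E _ [i <-] _ [j <-]]; [exact Z|].
  destruct (Nat.eq_dec r 0) as [->|Hr].
  { apply pr_inj in E as [_ <-]; exact Z. }
  set (n := pr r (pr (pr i j) (pr a (pr b (pr c (pr d (pr e g))))))).
  assert (R : rule_of n = pr (pr (thm i) (thm j)) H).
  { unfold rule_of, n; rewrite ?psnd_pr, ?pfst_pr; exact E. }
  exists n; rewrite thm_rule, R by (unfold n; now rewrite pfst_pr).
  unfold n; rewrite ?psnd_pr, ?pfst_pr, ?psnd_pr, ?pfst_pr, ?psnd_pr.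
  now rewrite !Nat.eqb_refl.
Qed.

Lemma eval_derivable k l y : eval k l y -> derivable (fact (enc k) (enc_list l) y).
Proof.
  (* The recursion is on the evaluation itself, because the premises of composition sit inside a
     [Forall2]. *)
  revert k l y; fix IH 4; intros k l y [v|x v|i v Hi|f gs v ys y' Hgs Hf|f g v y' Hf
    |f g n v z y' Hn Hg|f v n Hf Hpos].
  - apply (der_rule 1 (enc_list v) 0 0 0 0 0 fact0 fact0); (reflexivity || constructor).
  - apply (der_rule 2 x (enc_list v) 0 0 0 0 fact0 fact0); (reflexivity || constructor).
  - clear IH; revert i Hi; induction v as [|x v IHv]; simpl; intros i Hi; [lia|].
    destruct i as [|i].
    + apply (der_rule 3 x (enc_list v) 0 0 0 0 fact0 fact0); (reflexivity || constructor).
    + eapply (der_rule 4 i (enc_list v) (nth i v 0) x 0 0);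
        [reflexivity|apply IHv; lia|constructor].
  - rewrite enc_comp.
    eapply (der_rule 7 (encs gs) (enc_list v) (enc_list ys) (enc f) y' 0);
      [reflexivity| |apply (IH _ _ _ Hf)].
    clear Hf; induction Hgs as [|g z gs zs Hg Hgs IHgs].
    + apply (der_rule 5 (enc_list v) 0 0 0 0 0 fact0 fact0); (reflexivity || constructor).
    + eapply (der_rule 6 (enc g) (enc_list v) z (encs gs) (enc_list zs) 0);
        [reflexivity|apply (IH _ _ _ Hg)|apply IHgs].
  - eapply (der_rule 8 (enc f) (enc_list v) y' (enc g) 0 0);
      [reflexivity|apply (IH _ _ _ Hf)|constructor].
  - eapply (der_rule 9 (enc f) (enc g) n (enc_list v) z y');
      [reflexivity|apply (IH _ _ _ Hn)|apply (IH _ _ _ Hg)].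
  - eapply (der_rule 12 (enc f) n (enc_list v) 0 0 0);
      [reflexivity| |apply (IH _ _ _ Hf)].
    (* The positive values below [n] are then absorbed one at a time into the auxiliary fact for
       [cpos]. *)
    assert (D : forall m, m < n ->
              exists j, derivable (fact (enc f) (enc_list (m :: v)) (S j))).
    { intros m Hm; destruct (Hpos m Hm) as [j Hj]; exists j; apply (IH _ _ _ Hj). }
    clear Hf Hpos IH; induction n as [|n IHn].
    + apply (der_rule 10 (enc f) (enc_list v) 0 0 0 0 fact0 fact0);
        (reflexivity || constructor).
    + destruct (D n (Nat.lt_succ_diag_r n)) as [j Hj].
      eapply (der_rule 11 (enc f) n (enc_list v) j 0 0); [reflexivity| |apply Hj].
      apply IHn; intros m Hm; apply D; lia.
Qed.

(** Derivability of [(c, v, y)] only excludes values other than [y]; this weak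
    form of soundness suffices for codes of total functions. *)
Definition sound (c v y : nat) : Prop :=
  (forall k l z, c = enc k -> v = enc_list l -> eval k l z -> z = y) /\
  (forall ks l zs, c = encs ks -> v = enc_list l ->
     Forall2 (fun g z => eval g l z) ks zs -> enc_list zs = y) /\
  (forall k l n m, c = cpos (enc k) -> v = enc_list (n :: l) -> m < n ->
     ~ eval k (m :: l) 0).

Lemma enc_cons_inv x v l : vcons x v = enc_list l ->
  exists l', l = x :: l' /\ v = enc_list l'.
Proof.
  destruct l as [|x' l']; intros E; [discriminate|].
  injection E as E; apply pr_inj in E as [-> E]; eauto.
Qed.

Ltac invert_codes :=
  repeat match goal with
  | H : pr _ _ = pr _ _ |- _ => apply pr_inj in H; destruct H; try discriminate
  | H : S _ = S _ |- _ => apply Nat.succ_inj in H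
  | H : vcons _ _ = vcons _ _ |- _ => apply Nat.succ_inj in H
  | H : vcons _ _ = enc_list (_ :: _) |- _ => cbn [enc_list] in H
  | H : vcons _ _ = enc_list _ |- _ => apply enc_cons_inv in H as (? & -> & H)
  | H : pr _ _ = enc ?k |- _ =>
      destruct k; rewrite ?enc_comp in H; cbn [enc] in H;
      unfold czero, csucc, cproj, ccomp, cprec, cmu in H
  | H : pr _ _ = encs ?k |- _ =>
      destruct k; cbn [encs] in H; unfold cnil, ccons in H
  end; subst.

(** Each rule passes the three claims of [sound] from its premises to its conclusion, since
    inverting the injective codes leaves only the matching shape of evaluation. *)
Lemma derivable_sound F : derivable F -> forall c v y, F = fact c v y -> sound c v y.
Proof.
  induction 1 as [|r a b c d e g F G H E _ IHF _ IHG].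
  - intros c v y E; apply pr_inj in E as [<- E]; apply pr_inj in E as [<- <-].
    unfold sound, czero, cpos; split; [|split]; intros; invert_codes.
    now match goal with H : eval _ _ _ |- _ => inversion H end.
  - unfold sound, rule in *.
    repeat (destruct (r =? _); [apply pr_inj in E as [E <-]; apply pr_inj in E as [<- <-];
      intros c' v' y' E'; apply pr_inj in E' as [<- E']; apply pr_inj in E' as [<- <-];
      specialize (IHF _ _ _ eq_refl) as (F1 & F2 & F3);
      specialize (IHG _ _ _ eq_refl) as (G1 & G2 & G3);
      unfold czero, csucc, cproj, ccomp, cprec, cmu, cnil, ccons, cpos in *; split; [|split];
      intros; invert_codes
     |]).
    all: try match goal with
      | H : eval _ _ _ |- _ => inversion H; subst
      | H : Forall2 _ _ _ |- _ => inversion H; subst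
      end.
    all: try reflexivity; try lia; eauto.
    (* The remaining goals are, in order: the projection step, list cons, composition, the recursion
       step, the positivity step, minimization and the default rule. *)
    + apply (F1 (CProj a) x (nth a x 0)); auto. constructor; simpl in *; lia.
    + simpl; erewrite (F1 c0 l y), (G2 ks l l') by eauto; reflexivity.
    + erewrite <- F2 in G1 by eauto. eauto.
    + assert (z0 = e) as -> by (apply (F1 (CPrec k1 k2) (c :: x)); auto).
      apply (G1 k2 (c :: e :: x)); auto.
    + destruct (Nat.eq_dec m b) as [->|Hm].
      * intros Hk; specialize (G1 k (b :: l) 0 eq_refl eq_refl Hk); discriminate.
      * apply (F3 k l b m); auto; lia.
    (* A smaller minimum [z] contradicts positivity below [b]; a larger one would make the value at
       [b] positive, against the derived value 0. *)
    + destruct (lt_eq_lt_dec z b) as [[Hz|Hz]|Hz]; auto; exfalso.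
      * now apply (F3 k l b z).
      * match goal with H : forall m, m < z -> _ |- _ => destruct (H b Hz) as [j Hj] end.
        specialize (G1 k (b :: l) (S j) eq_refl eq_refl Hj); discriminate.
    + apply pr_inj in E as [E <-]; apply pr_inj in E as [<- _]; exact IHF.
Qed.

Lemma thm_eval k l y : eval k l y -> exists n, thm n = fact (enc k) (enc_list l) y.
Proof. intros; now apply derivable_thm, eval_derivable. Qed.

Lemma thm_unique n k l y z : thm n = fact (enc k) (enc_list l) y -> eval k l z -> z = y.
Proof.
  intros E Hz; destruct (derivable_sound _ (thm_derivable n) _ _ _ E) as (S1 & _ & _).
  exact (S1 k l z eq_refl eq_refl Hz).
Qed.

(** * Limit approximation of Delta^0_3 sets *)

(** The stage [t] bounds both the proof [n] and the innermost variable [c]; the value [z = 0]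
    asserts the relation and [z = 1] denies it. *)
Definition witnessed (t e z x a b : nat) : bool :=
  bex (fun n => bex (fun c =>
    thm n =? fact e (vcons x (vcons a (vcons b (vcons c 0)))) z) t) t.

Definition witnessed_all (t e z s x a : nat) : bool :=
  ball (fun b => witnessed t e z x a b) s.

(** [pfst e] searches for a witness [a] of [exists a, forall b, exists c, R x a b c],
    and [psnd e] for a refutation of the Pi^0_3 form; the first one found decides. *)
Definition approx (t e s x : nat) : bool :=
  bex (fun a => witnessed_all t (pfst e) 0 s x a &&
                negb (bex (fun i => witnessed_all t (psnd e) 1 s x i) a))%bool s.

Lemma recb_witnessed t e z x a b :
  rec t -> rec e -> rec z -> rec x -> rec a -> rec b ->
  recb (fun n => witnessed (t n) (e n) (z n) (x n) (a n) (b n)).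
Proof. intros; unfold witnessed, fact, vcons; solve_rec. Qed.

#[local] Hint Resolve recb_witnessed | 2 : rec.

Lemma recb_approx t e s x : rec t -> rec e -> rec s -> rec x ->
  recb (fun n => approx (t n) (e n) (s n) (x n)).
Proof. intros; unfold approx, witnessed_all; solve_rec. Qed.

#[local] Hint Resolve recb_approx | 2 : rec.

Definition eventually (P : nat -> Prop) : Prop := exists T, forall t, T <= t -> P t.

Lemma eventually_and P Q :
  eventually P -> eventually Q -> eventually (fun t => P t /\ Q t).
Proof.
  intros [T HT] [U HU]; exists (T + U); intros t Ht; split; [apply HT|apply HU]; lia.
Qed.

Lemma eventually_impl (P Q : nat -> Prop) :
  (forall t, P t -> Q t) -> eventually P -> eventually Q.
Proof. intros H [T HT]; exists T; auto. Qed.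

Lemma eventually_ge n : eventually (fun t => n <= t).
Proof. now exists n. Qed.

Lemma eventually_forall_lt (P : nat -> nat -> Prop) n :
  (forall i, i < n -> eventually (P i)) -> eventually (fun t => forall i, i < n -> P i t).
Proof.
  induction n as [|n IH]; intros H; [exists 0; intros; lia|].
  apply (eventually_impl (fun t => (forall i, i < n -> P i t) /\ P n t)).
  - intros t [H1 H2] i Hi; destruct (Nat.eq_dec i n) as [->|]; auto. apply H1; lia.
  - apply eventually_and; auto.
Qed.

(** If some [c] works, the search succeeds once [t] exceeds [c] and the number of a proof; otherwise
    it fails at every [t]. *)
Lemma eventually_witnessed e z x a b (R : nat -> Prop) :
  (forall c, R c <-> exists n, thm n = fact e (enc_list [x; a; b; c]) z) ->
  eventually (fun t => witnessed t e z x a b = true <-> exists c, R c).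
Proof.
  intros HR; destruct (classic (exists c, R c)) as [H|H].
  - destruct H as [c Hc]; destruct (proj1 (HR c) Hc) as [n Hn].
    exists (S (n + c)); intros t Ht; split; [eauto|intros _].
    apply bex_spec; exists n; split; [lia|].
    apply bex_spec; exists c; split; [lia|].
    apply Nat.eqb_eq; exact Hn.
  - exists 0; intros t _; split; [|tauto].
    intros B; apply bex_spec in B as (n & _ & B); apply bex_spec in B as (c & _ & B).
    exists c; apply HR; exists n; now apply Nat.eqb_eq in B.
Qed.

Lemma eventually_witnessed_all e z s x a (R : nat -> nat -> Prop) :
  (forall b c, R b c <-> exists n, thm n = fact e (enc_list [x; a; b; c]) z) ->
  eventually (fun t => witnessed_all t e z s x a = true <->
                       forall b, b < s -> exists c, R b c).
Proof.
  intros HR.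
  eapply eventually_impl; [|apply (eventually_forall_lt (fun b t =>
    witnessed t e z x a b = true <-> exists c, R b c) s)].
  - intros t H; unfold witnessed_all; rewrite ball_spec.
    split; intros K b Hb; apply H; auto.
  - intros b _; apply eventually_witnessed; auto.
Qed.

(** For large [t] the searches settle the quantifier over [c] for all [b < s]. As [s] grows, the
    finitely many false candidates ahead of a true witness or refutation are exposed, so the right
    side wins the race. *)
Lemma Delta03_approx A : Delta03 A ->
  exists e, forall x,
    eventually (fun s => eventually (fun t => approx t e s x = true <-> A x)).
Proof.
  intros [(R1 & (k1 & H1) & HA1) (R2 & (k2 & H2) & HA2)].
  (* A proof of the value 0 excludes the value 1, which the code would take if [R1] failed. *)
  assert (T1 : forall x a b c, R1 x a b c <->
            exists n, thm n = fact (enc k1) (enc_list [x; a; b; c]) 0).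
  { intros x a b c; split; [intros H; apply thm_eval, H1, H|].
    intros [n Hn]; apply NNPP; intros H.
    discriminate (thm_unique _ _ _ _ _ Hn (proj2 (H1 x a b c) H)). }
  assert (T2 : forall x a b c, ~ R2 x a b c <->
            exists n, thm n = fact (enc k2) (enc_list [x; a; b; c]) 1).
  { intros x a b c; split; [intros H; apply thm_eval, H2, H|].
    intros [n Hn] H.
    discriminate (thm_unique _ _ _ _ _ Hn (proj1 (H2 x a b c) H)). }
  exists (pr (enc k1) (enc k2)); intros x.
  set (L1 s a := forall b, b < s -> exists c, R1 x a b c).
  set (L2 s a := forall b, b < s -> exists c, ~ R2 x a b c).
  apply (eventually_impl (fun s =>
    (exists a, a < s /\ L1 s a /\ ~ (exists i, i < a /\ L2 s i)) <-> A x)).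
  { intros s Hs.
    eapply eventually_impl; [|apply (eventually_and _ _
      (eventually_forall_lt (fun a t => witnessed_all t (enc k1) 0 s x a = true <-> L1 s a) s
        (fun a _ => eventually_witnessed_all _ _ _ _ _ _ (T1 x a)))
      (eventually_forall_lt (fun a t => witnessed_all t (enc k2) 1 s x a = true <-> L2 s a) s
        (fun a _ => eventually_witnessed_all _ _ _ _ _ _ (T2 x a))))].
    intros t [K1 K2]; rewrite <- Hs; unfold approx; rewrite pfst_pr, psnd_pr, bex_spec.
    split; intros (a & Ha & Ba); exists a; split; auto.
    - apply andb_prop in Ba as [B1 B2].
      split; [now apply K1|]. intros (i & Hi & Li).
      apply Bool.negb_true_iff, Bool.not_true_iff_false in B2; apply B2.
      apply bex_spec; exists i; split; auto. apply K2; auto; lia.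
    - destruct Ba as [B1 B2]; apply andb_true_intro; split; [now apply K1|].
      apply Bool.negb_true_iff, Bool.not_true_iff_false; intros B.
      apply bex_spec in B as (i & Hi & Bi); apply B2; exists i; split; auto.
      apply K2; auto; lia. }
  assert (Q : forall (R : nat -> nat -> Prop),
             ~ (forall b, exists c, R b c) ->
             eventually (fun s => ~ (forall b, b < s -> exists c, R b c))).
  { intros R H; apply not_all_ex_not in H as [b Hb].
    exists (S b); intros s Hs K; apply Hb, K; lia. }
  destruct (classic (A x)) as [HA|HA].
  - destruct (proj1 (HA1 x) HA) as [a Ha].
    assert (N : eventually (fun s => forall i, i < a -> ~ L2 s i)).
    { apply (eventually_forall_lt (fun i s => ~ L2 s i)); intros i _; apply Q; intros K.
      destruct (proj1 (HA2 x) HA i) as [b Hb]; destruct (K b) as [c Hc]; auto. }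
    eapply eventually_impl; [|apply (eventually_and _ _ (eventually_ge (S a)) N)].
    intros s [Hs Hn]; split; [auto|intros _].
    exists a; split; [lia|split; [intros b _; apply Ha|]].
    intros (i & Hi & Li); exact (Hn i Hi Li).
  - assert (exists a, forall b, exists c, ~ R2 x a b c) as [a Ha].
    { apply NNPP; intros K; apply HA, HA2; intros a.
      apply NNPP; intros K'; apply K; exists a; intros b.
      apply not_all_ex_not; intros K''; apply K'; now exists b. }
    (* The bound is [S a] because [approx] lets a witness win a tie against a refutation with the
       same index. *)
    assert (N : eventually (fun s => forall i, i < S a -> ~ L1 s i)).
    { apply (eventually_forall_lt (fun i s => ~ L1 s i)); intros i _; apply Q; intros K.
      apply HA, HA1; now exists i. }
    eapply eventually_impl; [|exact N].
    intros s Hn; split; [|tauto].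
    intros (i & Hi & Li & K); exfalso.
    destruct (Nat.lt_ge_cases i (S a)) as [L|L]; [exact (Hn i L Li)|].
    apply K; exists a; split; [lia|]. intros b _; apply Ha.
Qed.

(** * The colouring *)

(** The default [2 ^ S a] signals that no element was found, as any number with top bit [a] is
    smaller. *)
Definition wit (t b e a : nat) : nat :=
  bmin (fun x => (Nat.log2 x =? a) && approx t e b x)%bool (2 ^ S a).

(** [pick t b a] is the least index [e < b] not picked at any [i < a] whose
    approximation contains an [x] with top bit [a]; it is [b] if there is none. *)
Definition pick_step (t b a T : nat) : nat :=
  bmin (fun e => (wit t b e a <? 2 ^ S a) &&
                 negb (bex (fun i => lookup T a i =? e) a))%bool b.

Definition pick (t b a : nat) : nat := cov (pick_step t b) a.

(** [col t u] adds up, modulo 2, a weight for each pair [a < b] of consecutive bits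
    of [u].  If [x] is the element chosen at [(a, b)], this weight is [1 + col t x],
    which makes [col t (x + 2 ^ b)] odd. *)
Definition col_step (t u T : nat) : nat :=
  let b := Nat.log2 u in
  let v := u - 2 ^ b in
  let a := Nat.log2 v in
  let e := pick t b a in
  if v =? 0 then 0
  else Nat.b2n (Nat.odd (lookup T u v +
         if e <? b then S (lookup T u (wit t b e a)) else 0)).

Definition col (t u : nat) : nat := cov (col_step t) u.

(** Reading the stage off the top bit gives [w1 + w2] and [x + w1 + w2] the same stage when
    [x << w1 << w2]. *)
Definition colour (z : nat) : nat := col (Nat.log2 z) z.

Lemma rec_wit t b e a : rec t -> rec b -> rec e -> rec a ->
  rec (fun n => wit (t n) (b n) (e n) (a n)).
Proof. intros; unfold wit; solve_rec. Qed.

#[local] Hint Resolve rec_wit | 2 : rec.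

Lemma rec_pick t b a : rec t -> rec b -> rec a -> rec (fun n => pick (t n) (b n) (a n)).
Proof. intros; unfold pick, pick_step; solve_rec. Qed.

#[local] Hint Resolve rec_pick | 2 : rec.

Lemma rec_colour : rec colour.
Proof. unfold colour, col, col_step; cbv zeta; solve_rec. Qed.

Lemma pick_spec t b a : pick t b a < b ->
  wit t b (pick t b a) a < 2 ^ S a /\ forall i, i < a -> pick t b i <> pick t b a.
Proof.
  intros H. pose proof (bmin_true _ _ H) as B; cbv beta in B.
  change (bmin _ b) with (pick t b a) in B.
  apply andb_prop in B as [B1 B2]; split; [now apply Nat.ltb_lt in B1|].
  intros i Hi E; apply Bool.negb_true_iff, Bool.not_true_iff_false in B2; apply B2.
  apply bex_spec; exists i; split; auto.
  rewrite lookup_tab by auto. now apply Nat.eqb_eq.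
Qed.

Lemma pick_least t b a e : e < b -> wit t b e a < 2 ^ S a ->
  (forall i, i < a -> pick t b i <> e) -> pick t b a <= e.
Proof.
  intros He Hw Hi; apply bmin_first; auto.
  apply andb_true_intro; split; [now apply Nat.ltb_lt|].
  apply Bool.negb_true_iff, Bool.not_true_iff_false; intros B.
  apply bex_spec in B as (i & Hia & B); apply Nat.eqb_eq in B.
  rewrite lookup_tab in B by auto. now apply (Hi i).
Qed.

Definition weight (t a b : nat) : nat :=
  if pick t b a <? b then S (col t (wit t b (pick t b a) a)) else 0.

Lemma log2_add_pow2 v b : v < 2 ^ b -> Nat.log2 (v + 2 ^ b) = b.
Proof. intros H; apply Nat.log2_unique; [lia|]. rewrite Nat.pow_succ_r'; lia. Qed.

Lemma col_pow2 t b : col t (2 ^ b) = 0.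
Proof.
  change (col_step t (2 ^ b) (tab (col_step t) (2 ^ b)) = 0); unfold col_step; cbv zeta.
  now rewrite Nat.log2_pow2, Nat.sub_diag by lia.
Qed.

(** A picked index has its witness below [2 ^ S (log2 v) <= 2 ^ b], hence below the argument, so the
    table lookup yields the true colour of the witness. *)
Lemma col_add_pow2 t v b : 0 < v -> v < 2 ^ b ->
  col t (v + 2 ^ b) = Nat.b2n (Nat.odd (col t v + weight t (Nat.log2 v) b)).
Proof.
  intros H0 H1; set (u := v + 2 ^ b).
  change (col_step t u (tab (col_step t) u)
          = Nat.b2n (Nat.odd (col t v + weight t (Nat.log2 v) b))).
  unfold col_step; cbv zeta.
  assert (Nat.log2 u = b) as -> by now apply log2_add_pow2.
  assert (u - 2 ^ b = v) as -> by (unfold u; lia).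
  destruct (Nat.eqb_spec v 0) as [?|_]; [lia|].
  rewrite lookup_tab by (unfold u; lia).
  fold (col t v); do 3 f_equal; unfold weight.
  destruct (Nat.ltb_spec (pick t b (Nat.log2 v)) b) as [L|_]; auto.
  pose proof (proj1 (pick_spec _ _ _ L)) as W.
  apply Nat.log2_lt_pow2 in H1; auto.
  assert (2 ^ S (Nat.log2 v) <= 2 ^ b) by (apply Nat.pow_le_mono_r; lia).
  rewrite lookup_tab by (unfold u; lia). reflexivity.
Qed.

(** * Lowest bits and sums of numbers with separated bits *)

Lemma tz_spec f x : 0 < x <= f -> exists q, x = 2 ^ tz f x * (2 * q + 1).
Proof.
  revert x; induction f as [|f IH]; intros x Hx; [lia|]; cbn [tz].
  destruct (Nat.odd x) eqn:E.
  - apply Nat.odd_spec in E as [q ->]; exists q; simpl; lia.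
  - assert (x = 2 * Nat.div2 x) as D.
    { pose proof (Nat.div2_odd x) as D; rewrite E in D; simpl Nat.b2n in D; lia. }
    destruct (IH (Nat.div2 x)) as [q Hq]; [lia|]. exists q.
    rewrite Nat.pow_succ_r', <- Nat.mul_assoc, <- Hq; exact D.
Qed.

Lemma lambda_spec x : 0 < x -> exists q, x = 2 ^ lambda x * (2 * q + 1).
Proof. intros; apply tz_spec; lia. Qed.

Lemma pow2_odd_inj i j q r : 2 ^ i * (2 * q + 1) = 2 ^ j * (2 * r + 1) -> i = j.
Proof.
  revert j; induction i as [|i IH]; intros [|j] E; auto.
  - rewrite Nat.pow_succ_r', Nat.pow_0_r, <- Nat.mul_assoc in E; lia.
  - rewrite Nat.pow_succ_r', Nat.pow_0_r, <- Nat.mul_assoc in E; lia.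
  - f_equal; apply IH. rewrite !Nat.pow_succ_r', <- !Nat.mul_assoc in E; lia.
Qed.

Lemma lambda_unique x l q : x = 2 ^ l * (2 * q + 1) -> lambda x = l.
Proof.
  intros E; destruct (lambda_spec x) as [r Hr].
  - subst x; pose proof (Nat.pow_nonzero 2 l); nia.
  - rewrite E in Hr at 1; symmetry; eapply pow2_odd_inj; exact Hr.
Qed.

Lemma lambda_pow2 b : lambda (2 ^ b) = b.
Proof. apply (lambda_unique _ b 0); lia. Qed.

Lemma pow2_lambda_le x : 0 < x -> 2 ^ lambda x <= x.
Proof. intros H; destruct (lambda_spec x H) as [q Hq]; nia. Qed.

Lemma lambda_le_log2 x : 0 < x -> lambda x <= Nat.log2 x.
Proof. intros H; apply Nat.log2_le_pow2; auto. now apply pow2_lambda_le. Qed.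

Lemma lambda_add_mul x k m : 0 < x < 2 ^ k -> lambda (x + 2 ^ k * m) = lambda x.
Proof.
  intros [H0 H1]; destruct (lambda_spec x H0) as [q Hq].
  assert (lambda x < k) as L.
  { apply (Nat.pow_lt_mono_r_iff 2); [lia|]. pose proof (pow2_lambda_le x H0); lia. }
  apply (lambda_unique _ _ (q + 2 ^ (k - S (lambda x)) * m)).
  replace (2 ^ k) with (2 ^ lambda x * (2 * 2 ^ (k - S (lambda x)))).
  - rewrite Hq at 1; ring.
  - rewrite <- Nat.pow_succ_r', <- Nat.pow_add_r; f_equal; lia.
Qed.

Lemma lambda_add x w : 0 < x -> 0 < w -> x < 2 ^ lambda w -> lambda (x + w) = lambda x.
Proof.
  intros Hx Hw L; destruct (lambda_spec w Hw) as [q Hq].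
  rewrite Hq at 1; now apply lambda_add_mul.
Qed.

Lemma add_lt_pow2 x w b : 0 < w -> x < 2 ^ lambda w -> w < 2 ^ b -> x + w < 2 ^ b.
Proof.
  intros Hw Hx Hb; destruct (lambda_spec w Hw) as [q Hq].
  assert (lambda w < b) as L.
  { apply (Nat.pow_lt_mono_r_iff 2); [lia|]. pose proof (pow2_lambda_le w Hw); lia. }
  assert (2 ^ b = 2 ^ lambda w * 2 ^ (b - lambda w)) as E.
  { rewrite <- Nat.pow_add_r; f_equal; lia. }
  assert (2 * q + 1 < 2 ^ (b - lambda w)) by nia.
  nia.
Qed.

Lemma log2_add x w : 0 < w -> x < 2 ^ lambda w -> Nat.log2 (x + w) = Nat.log2 w.
Proof.
  intros Hw Hx; destruct (Nat.log2_spec w Hw) as [L1 L2].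
  apply Nat.log2_unique; [lia|]. split; [lia|]. now apply add_lt_pow2.
Qed.

Lemma odd_b2n b : Nat.odd (Nat.b2n b) = b.
Proof. now destruct b. Qed.

Lemma split_top w : 0 < w -> exists v, w = v + 2 ^ Nat.log2 w /\ v < 2 ^ Nat.log2 w.
Proof.
  intros H; destruct (Nat.log2_spec w H) as [L1 L2].
  rewrite Nat.pow_succ_r' in L2; exists (w - 2 ^ Nat.log2 w); lia.
Qed.

(** Putting [x] below [w] creates just one new pair of consecutive bits, at [(log2 x, lambda w)].
    Induction strips the top bit of [w]: the weight of the topmost pair sees only [log2 v], which
    adding [x] does not change. *)
Lemma odd_col_add t x w : 0 < x -> 0 < w -> x < 2 ^ lambda w ->
  Nat.odd (col t (x + w)) = xorb (Nat.odd (col t (x + 2 ^ lambda w))) (Nat.odd (col t w)).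
Proof.
  intros Hx; induction w as [w IH] using lt_wf_ind; intros Hw L.
  destruct (split_top w Hw) as (v & E & Hv); remember (Nat.log2 w) as b eqn:Eb.
  destruct (Nat.eq_dec v 0) as [->|Hv0].
  { simpl in E; subst w; rewrite lambda_pow2, col_pow2. now destruct (Nat.odd _). }
  assert (lambda w = lambda v) as El.
  { rewrite E; replace (2 ^ b) with (2 ^ b * 1) by lia. apply lambda_add_mul; lia. }
  rewrite El in *.
  assert (x + v < 2 ^ b) as Hxv by (apply add_lt_pow2; lia).
  assert (Nat.log2 (x + v) = Nat.log2 v) as Elog by (apply log2_add; lia).
  rewrite E, Nat.add_assoc, (col_add_pow2 _ (x + v)), (col_add_pow2 _ v) by lia.
  rewrite !odd_b2n, !Nat.odd_add, Elog, IH by lia.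
  now rewrite Bool.xorb_assoc.
Qed.

(** * Diagonalization *)

Lemma wit_spec t b e a : wit t b e a < 2 ^ S a ->
  Nat.log2 (wit t b e a) = a /\ approx t e b (wit t b e a) = true.
Proof.
  intros H; apply bmin_true, andb_prop in H as [H1 H2].
  split; [now apply Nat.eqb_eq|exact H2].
Qed.

(* Each [e' < e] is picked at most once, so among [e + 1] top bits available to [e]
   one is picked by [e]. *)
Lemma pick_reaches t b e (l : list nat) : e < b -> NoDup l -> e < length l ->
  (forall a, In a l -> wit t b e a < 2 ^ S a) ->
  exists a m, In m l /\ a <= m /\ pick t b a = e.
Proof.
  intros He Hl Hlen Hw; apply NNPP; intros H.
  (* The bit given to [e] may lie outside [l], since [e] can be served before reaching a listed bit
     [m]. *)
  assert (Hne : forall a m, In m l -> a <= m -> pick t b a <> e)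
    by (intros a m Hm Ha E; apply H; eauto).
  assert (Hlt : forall a, In a l -> pick t b a < e).
  { intros a Ha.
    assert (pick t b a <= e)
      by (apply pick_least; auto; intros i Hi; apply (Hne i a); auto; lia).
    specialize (Hne a a Ha (Nat.le_refl a)); lia. }
  assert (ND : NoDup (map (pick t b) l)).
  { apply NoDup_map_NoDup_ForallPairs; auto.
    intros i j Hi Hj E; pose proof (Hlt i Hi); pose proof (Hlt j Hj).
    destruct (lt_eq_lt_dec i j) as [[L|L]|L]; auto; exfalso.
    - now apply (proj2 (pick_spec t b j ltac:(lia)) i L).
    - now apply (proj2 (pick_spec t b i ltac:(lia)) j L). }
  assert (Hincl : incl (map (pick t b) l) (seq 0 e)).
  { intros y Hy; apply in_map_iff in Hy as (a & <- & Ha).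
    apply in_seq; specialize (Hlt a Ha); lia. }
  pose proof (NoDup_incl_length ND Hincl) as L.
  rewrite length_map, length_seq in L; lia.
Qed.

Lemma infinite_log2_list A n : infinite_set A ->
  exists l, NoDup l /\ length l = n /\ forall a, In a l -> exists x, A x /\ Nat.log2 x = a.
Proof.
  intros HA; induction n as [|n (l & H1 & H2 & H3)].
  - exists []; repeat split; [constructor|intros a []].
  - destruct (HA (2 ^ S (list_max l))) as (x & Hx & Ax).
    exists (Nat.log2 x :: l); repeat split.
    + constructor; auto. intros Hin.
      assert (Nat.log2 x <= list_max l).
      { apply (proj1 (Forall_forall _ _) (proj1 (list_max_le l _) (Nat.le_refl _)) _ Hin). }
      assert (S (list_max l) <= Nat.log2 x); [|lia].
      apply Nat.log2_le_pow2; lia.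
    + simpl; lia.
    + intros a [<-|Ha]; eauto.
Qed.

(** The element [x] chosen for index [e] has top bit below [M], where the approximation is correct,
    so it lies in [A]. The weight [1 + col t x] added to [col t x] is odd. *)
Lemma exists_odd_col A t b e M (l : list nat) :
  (forall x, A x -> 0 < x) -> e < b -> M <= b -> NoDup l -> e < length l ->
  (forall a, In a l -> a < M /\ exists x, A x /\ Nat.log2 x = a) ->
  (forall x, x < 2 ^ M -> (approx t e b x = true <-> A x)) ->
  exists x, A x /\ Nat.log2 x < b /\ Nat.odd (col t (x + 2 ^ b)) = true.
Proof.
  intros Hpos He HM Hl Hlen Ha Hap.
  destruct (pick_reaches t b e l) as (a & m & Hm & Ham & Hp); auto.
  { intros a Hin; destruct (Ha a Hin) as (HaM & x & Ax & Lx).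
    pose proof (Nat.log2_spec x (Hpos x Ax)) as [_ L]; rewrite Lx in L.
    apply Nat.le_lt_trans with x; auto.
    apply bmin_first; auto. apply andb_true_intro; split; [now apply Nat.eqb_eq|].
    apply Hap; auto. apply Nat.lt_le_trans with (1 := L), Nat.pow_le_mono_r; lia. }
  destruct (Ha m Hm) as [HmM _].
  assert (Hpb : pick t b a < b) by lia.
  destruct (pick_spec _ _ _ Hpb) as [W _]; rewrite Hp in W.
  destruct (wit_spec _ _ _ _ W) as [W1 W2]; set (x := wit t b e a) in *.
  assert (L : 2 ^ S a <= 2 ^ M) by (apply Nat.pow_le_mono_r; lia).
  assert (L' : 2 ^ M <= 2 ^ b) by (apply Nat.pow_le_mono_r; lia).
  assert (Ax : A x) by (apply Hap; auto; lia).
  exists x; split; [exact Ax|split; [lia|]].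
  rewrite col_add_pow2, odd_b2n by (auto; lia).
  unfold weight; rewrite W1, Hp, (proj2 (Nat.ltb_lt e b) He); fold x.
  rewrite Nat.add_succ_r, Nat.odd_succ, Nat.even_add. now destruct (Nat.even _).
Qed.

(** Each value of [lambda] is taken at most twice on [A], so the elements with [lambda x < n] are
    bounded, and an element of [A] beyond that bound works. *)
Lemma weak_apartness_lambda A n : weak_apartness A -> infinite_set A ->
  exists x, A x /\ n <= lambda x.
Proof.
  intros [_ HW] HA.
  assert (exists B, forall x, A x -> lambda x < n -> x <= B) as [B HB].
  { induction n as [|n [B HB]]; [exists 0; intros; lia|].
    assert (exists C, forall x, A x -> lambda x = n -> x <= C) as [C HC].
    { destruct (classic (exists y, A y /\ lambda y = n)) as [(y & Ay & Ly)|N].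
      2:{ exists 0; intros x Ax Lx; exfalso; eauto. }
      destruct (classic (exists z, A z /\ lambda z = n /\ z <> y)) as [(z & Az & Lz & Nz)|N].
      - exists (y + z); intros x Ax Lx.
        destruct (HW n x y z) as [|[|]]; auto; subst; lia.
      - exists y; intros x Ax Lx. destruct (Nat.eq_dec x y); [lia|].
        exfalso; apply N; eauto. }
    exists (B + C); intros x Ax Lx.
    destruct (Nat.eq_dec (lambda x) n) as [E|E].
    - specialize (HC x Ax E); lia.
    - specialize (HB x Ax ltac:(lia)); lia. }
  destruct (HA B) as (x & Hx & Ax); exists x; split; auto.
  destruct (Nat.le_gt_cases n (lambda x)); auto. specialize (HB x Ax); lia.
Qed.

Lemma colour_lt n : colour n < 2.
Proof.
  unfold colour, col; change (col_step (Nat.log2 n) n (tab (col_step (Nat.log2 n)) n) < 2).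
  unfold col_step; cbv zeta. destruct (_ =? 0); [lia|]. destruct (Nat.odd _); simpl; lia.
Qed.

Lemma log2_lt_lambda_ll x y : 0 < x -> 0 < y -> Nat.log2 x < lambda y -> ll x y.
Proof.
  intros Hx Hy L; split; [|exact L].
  apply Nat.log2_lt_cancel. pose proof (lambda_le_log2 y Hy); lia.
Qed.

Lemma colour_diagonal A : Delta03 A -> (forall x, A x -> 0 < x) ->
  infinite_set A -> weak_apartness A ->
  exists x w1 w2, A x /\ A w1 /\ A w2 /\ ll x w1 /\ ll w1 w2 /\
                  colour (w1 + w2) <> colour (x + w1 + w2).
Proof.
  intros HD Hpos Hinf Hw.
  destruct (Delta03_approx A HD) as [e He].
  destruct (infinite_log2_list A (S e) Hinf) as (l & Hl & Hlen & Ha).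
  set (M := S (list_max l)).
  assert (HaM : forall a, In a l -> a < M).
  { intros a Hin; apply Nat.lt_succ_r.
    apply (proj1 (Forall_forall _ _) (proj1 (list_max_le l _) (Nat.le_refl _)) _ Hin). }
  destruct (eventually_forall_lt _ (2 ^ M) (fun x _ => He x)) as [S0 HS].
  (* With [b = lambda w1], the three summands ensure that the outer limit has settled at [b], that
     the candidates lie below [2 ^ b], and that [e < b] may be picked. *)
  destruct (weak_apartness_lambda A (S (S0 + M + e)) Hw Hinf) as (w1 & A1 & L1).
  set (b := lambda w1) in *.
  destruct (eventually_forall_lt _ (2 ^ M) (HS b ltac:(lia))) as [T HT].
  (* The common stage [log2 w2] is at least [lambda w2], hence past [T], where the inner limit at
     [b] has settled; the other summand separates [w1] from [w2]. *)
  destruct (weak_apartness_lambda A (S (T + Nat.log2 w1)) Hw Hinf) as (w2 & A2 & L2).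
  pose proof (Hpos _ A1) as P1; pose proof (Hpos _ A2) as P2.
  pose proof (lambda_le_log2 w2 P2) as L2'.
  destruct (exists_odd_col A (Nat.log2 w2) b e M l) as (x & Ax & Lx & Ox); auto; try lia.
  { intros x Hx; apply HT; auto; lia. }
  pose proof (Hpos _ Ax) as Px.
  exists x, w1, w2; repeat (split; [now auto using log2_lt_lambda_ll|]).
  split; [apply log2_lt_lambda_ll; lia|].
  assert (B1 : w1 < 2 ^ lambda w2) by (apply Nat.log2_lt_pow2; lia).
  assert (El : lambda (w1 + w2) = b) by now apply lambda_add.
  assert (Bx : x < 2 ^ lambda (w1 + w2)) by (rewrite El; apply Nat.log2_lt_pow2; lia).
  rewrite <- Nat.add_assoc; unfold colour.
  rewrite (log2_add x (w1 + w2)), (log2_add w1 w2) by lia.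
  intros E; apply (f_equal Nat.odd) in E.
  (* At the common stage the two parities differ by that of [col] at [x + 2 ^ b], which is odd. *)
  rewrite (odd_col_add _ x (w1 + w2)), El, Ox in E by lia.
  destruct (Nat.odd (col _ (w1 + w2))); discriminate E.
Qed.

Theorem theorem2p7 :
  exists r : nat, 2 <= r /\
  exists c : nat -> nat, recursive_fun c /\ (forall n, c n < r) /\
  forall A : nat -> Prop,
    Delta03 A -> (forall x, A x -> 0 < x) -> infinite_set A -> weak_apartness A ->
    (exists x w1 w2, A x /\ A w1 /\ A w2 /\ ll x w1 /\ ll w1 w2 /\
                     c (w1 + w2) <> c (x + w1 + w2)) /\
    ~ (exists col, forall s, FS3 A s -> c s = col).
Proof.
  exists 2; split; [lia|].
  exists colour; split; [exact rec_colour|split; [exact colour_lt|]].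
  intros A HD Hpos Hinf Hw.
  pose proof (colour_diagonal A HD Hpos Hinf Hw) as D; split; [exact D|].
  destruct D as (x & w1 & w2 & Ax & A1 & A2 & [L1 _] & [L2 _] & D).
  intros [k Hk]; apply D; rewrite (Hk (w1 + w2)), (Hk (x + w1 + w2)); auto.
  - exists [x; w1; w2]; simpl; repeat split; try lia.
    + repeat constructor; simpl; lia.
    + intros y [<-|[<-|[<-|[]]]]; auto.
  - exists [w1; w2]; simpl; repeat split; try lia.
    + repeat constructor; simpl; lia.
    + intros y [<-|[<-|[]]]; auto.
Qed.
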